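(* Consider the following algorithm for the Monotone Submodular $k$-Multiway Partitioning problem (Mon-Sub-$k$-MP). On input a ground set $V=\{v_1,\dots,v_n\}$, an integer $k$, and a function $f$ on $2^V$ given by a value oracle: sort and rename the elements so that $f(\{v_1\})\le f(\{v_2\})\le\cdots\le f(\{v_n\})$, and output $(S_1,\dots,S_k)$ where $S_i=\{v_i\}$ for $1\le i\le k-1$ and $S_k=V\setminus\{v_1,\dots,v_{k-1}\}$. This algorithm is a $2$-approximation algorithm for Mon-Sub-$k$-MP running in time $O(n\,EO+n\log n)$, where $EO$ denotes the time that a call to the value oracle takes.
   Context: Mon-Sub-$k$-MP: given a finite ground set $V$ with $|V|=n$, an integer $1\le k\le n$, and a non-negative monotone submodular function $f:2^V\to\mathbb{R}_+$, find $$\min \sum_{i=1}^k f(S_i)\quad\text{s.t. } S_1\uplus S_2\uplus\cdots\uplus S_k=V,\ S_i\neq\emptyset \text{ for all } i\in\{1,\dots,k\},$$ where $\uplus$ denotes union of pairwise disjoint sets. Here $f$ is submodular if $f(A\cup\{v\})-f(A)\ge f(B\cup\{v\})-f(B)$ for all $A\subseteq B\subseteq V$ and $v\notin B$, and monotone if $f(A)\le f(B)$ whenever $A\subseteq B\subseteq V$. A value oracle returns $f(S)$ when queried with a set $S\subseteq V$. A $2$-approximation algorithm outputs, on every instance, a feasible solution of value at most twice the optimal value. *)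

(* Defs.v *)
From Stdlib Require Import String.
From HB Require Import structures.
From mathcomp Require Import all_boot all_order all_algebra reals.

Set Implicit Arguments.
Unset Strict Implicit.
Unset Printing Implicit Defensive.

Import Order.TTheory GRing.Theory Num.Theory.
Local Open Scope ring_scope.

Section Problem.
Context {R : realType} {T : finType}.
Implicit Types (f : {set T} -> R) (k : nat).

Definition nonnegative f := forall A : {set T}, 0 <= f A.

Definition monotone f := forall A B : {set T}, A \subset B -> f A <= f B.

Definition submodular f := forall (A B : {set T}) (v : T),
  A \subset B -> v \notin B -> f (v |: B) - f B <= f (v |: A) - f A.

(* The ground set V is the whole type T, so n = #|T|. *)
Definition instance f k :=
  [/\ (1 <= k <= #|T|)%N, nonnegative f, monotone f & submodular f].

Definition feasible k (S : k.-tuple {set T}) :=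
  [/\ \bigcup_(i < k) tnth S i = [set: T],
      forall i j : 'I_k, i != j -> [disjoint tnth S i & tnth S j]
    & forall i : 'I_k, tnth S i != set0].

Definition value f k (S : k.-tuple {set T}) : R := \sum_(i < k) f (tnth S i).

Definition optimal f k (S : k.-tuple {set T}) :=
  feasible S /\ forall S' : k.-tuple {set T}, feasible S' -> value f S <= value f S'.

Definition approx_solution (alpha : R) f k (S : k.-tuple {set T}) :=
  feasible S /\
  exists Sopt : k.-tuple {set T},
    optimal f Sopt /\ value f S <= alpha * value f Sopt.

(* S is a possible output of the algorithm; ties between equal singleton
   values may be broken in any way. *)
Definition algorithm_output f k (S : k.-tuple {set T}) :=
  exists v : seq T,
    [/\ perm_eq v (enum T),
        sorted (fun x y => f [set x] <= f [set y]) v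
      & tval S = rcons [seq [set x] | x <- take k.-1 v]
                       (~: [set x in take k.-1 v])].

End Problem.

(* Running times are measured in a first-order, call-by-value language with
   recursive functions over cons cells.  Every evaluation step costs one time
   unit, including a comparison of two reals, except an oracle call, which
   costs EO.  A program is a finite table of functions. *)
Inductive term :=
| Var of string
| Let of string & term & term                    (* let x := a in b *)
| Nil
| Cons of term & term
| IfNil of term & term & string & string & term  (* if a is x :: y then c else b *)
| IfZero of term & term & string & term          (* if a is x.+1 then c else b *)
| IfLe of term & term & term & term              (* if a <= b then c else d *)
| Query of term
| Call of string & seq string.

Definition program := seq (string * (seq string * term)).

Fixpoint assoc (A : Type) (x : string) (s : seq (string * A)) : option A :=
  if s is (y, a) :: s' then if String.eqb x y then Some a else assoc x s' else None.

(* VCons builds lists (ending in VNil) as well as pairs. *)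
Inductive datum (R T : Type) :=
| VElt of T
| VReal of R
| VNat of nat
| VNil
| VCons of datum R T & datum R T.
Arguments VElt {R T}.
Arguments VReal {R T}.
Arguments VNat {R T}.
Arguments VNil {R T}.
Arguments VCons {R T}.

Definition vlist (R T : Type) (s : seq (datum R T)) : datum R T := foldr VCons VNil s.

(* A subset of T is represented by a list of its elements. *)
Definition velts (R T : Type) (s : seq T) : datum R T := vlist [seq VElt x | x <- s].
Arguments velts {R T}.

Section Semantics.
Context {R : realType} {T : finType}.
Variables (p : program) (f : {set T} -> R) (EO : nat).
Local Notation env := (seq (string * datum R T)).
Local Open Scope nat_scope.

(* [eval e a w t]: in the environment e, the term a evaluates to w in time t. *)
Inductive eval : env -> term -> datum R T -> nat -> Prop :=
| EVar e x w : assoc x e = Some w -> eval e (Var x) w 1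
| ELet e x a b w1 w2 t1 t2 :
    eval e a w1 t1 -> eval ((x, w1) :: e) b w2 t2 ->
    eval e (Let x a b) w2 (t1 + t2).+1
| ENil e : eval e Nil VNil 1
| ECons e a b w1 w2 t1 t2 :
    eval e a w1 t1 -> eval e b w2 t2 ->
    eval e (Cons a b) (VCons w1 w2) (t1 + t2).+1
| EIfNil_nil e a b x y c w t1 t2 :
    eval e a VNil t1 -> eval e b w t2 ->
    eval e (IfNil a b x y c) w (t1 + t2).+1
| EIfNil_cons e a b x y c w1 w2 w t1 t2 :
    eval e a (VCons w1 w2) t1 -> eval ((x, w1) :: (y, w2) :: e) c w t2 ->
    eval e (IfNil a b x y c) w (t1 + t2).+1
| EIfZero_0 e a b x c w t1 t2 :
    eval e a (VNat 0) t1 -> eval e b w t2 ->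
    eval e (IfZero a b x c) w (t1 + t2).+1
| EIfZero_S e a b x c m w t1 t2 :
    eval e a (VNat m.+1) t1 -> eval ((x, VNat m) :: e) c w t2 ->
    eval e (IfZero a b x c) w (t1 + t2).+1
| EIfLe_true e a b c d r s w t1 t2 t3 :
    eval e a (VReal r) t1 -> eval e b (VReal s) t2 -> (r <= s)%R ->
    eval e c w t3 ->
    eval e (IfLe a b c d) w (t1 + t2 + t3).+1
| EIfLe_false e a b c d r s w t1 t2 t3 :
    eval e a (VReal r) t1 -> eval e b (VReal s) t2 -> (s < r)%R ->
    eval e d w t3 ->
    eval e (IfLe a b c d) w (t1 + t2 + t3).+1
| EQuery e a s t :
    eval e a (velts s) t ->
    eval e (Query a) (VReal (f [set x in s])) (t + EO)
| ECall e g xs ws ys b w t :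
    assoc g p = Some (ys, b) ->
    [seq assoc x e | x <- xs] = [seq Some u | u <- ws] ->
    size ys = size ws ->
    eval (zip ys ws) b w t ->
    eval e (Call g xs) w t.+1.

End Semantics.

Lemma eval_det {R : realType} {T : finType} (p : program) (f : {set T} -> R) EO e a w t :
  eval p f EO e a w t -> forall w' t', eval p f EO e a w' t' -> w = w' /\ t = t'.
Proof.
have inj : injective (@velts R T).
  by elim=> [|x s IH] [|y s'] //= [-> /IH ->].
elim=> {e a w t}.
all: intros; match goal with H : eval _ _ _ _ _ _ _ |- _ => inversion H; subst; clear H end.
all: repeat match goal with
 | IH : (forall w t, eval ?p ?f ?EO ?e ?a w t -> _), H : eval ?p ?f ?EO ?e ?a _ _ |- _ =>
   let E1 := fresh in let E2 := fresh in
   case: (IH _ _ H) => E1 E2; clear H; try (injection E1; intros); try discriminate E1; subst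
 end.
all: try by [].
- by rewrite H in H3; case: H3.
- by exfalso; move: (le_lt_trans H3 H16); rewrite ltxx.
- by exfalso; move: (le_lt_trans H16 H3); rewrite ltxx.
- match goal with H : velts _ = velts _ |- _ => by rewrite (inj _ _ H) end.
- match goal with H : assoc g p = Some (ys, b), H' : assoc g p = _ |- _ => rewrite H in H'; case: H' => ? ?; subst end.
  have E : ws = ws0.
    match goal with H : map _ xs = map _ ws, H' : map _ xs = _ |- _ => rewrite H in H'; move: H' end.
    clear; elim: ws ws0 => [|x s IH] [|y s'] //= [-> /IH ->] //.
  subst. match goal with H : eval _ _ _ (zip _ _) _ w' _, IH : (forall _ _ , _ -> _) |- _ => by case: (IH _ _ H) => -> -> end.
Qed.

(* The program p, run on the ground set listed as l and the integer k with
   value oracle f, outputs the sets S_1, ..., S_k in time t. *)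
Definition runs {R : realType} {T : finType} (p : program) (f : {set T} -> R)
    (EO : nat) (l : seq T) (k : nat) (S : k.-tuple {set T}) (t : nat) :=
  exists ss : seq (seq T),
    [/\ all uniq ss, [seq [set x in s] | s <- ss] = S
      & eval p f EO [:: ("l"%string, velts l); ("k"%string, VNat k)]
          (Call "main" [:: "l"%string; "k"%string])
          (vlist [seq velts s | s <- ss]) t].

Section Algorithm.
Local Open Scope string_scope.
Local Coercion Var : string >-> term.

(* Pair every element with the value of its singleton. *)
Definition queries_fun : seq string * term :=
  ([:: "l"],
   IfNil "l" Nil "x" "l'"
     (Cons (Cons "x" (Query (Cons "x" Nil))) (Call "queries" [:: "l'"]))).

Definition split_fun : seq string * term :=
  ([:: "l"],
   IfNil "l" (Cons Nil Nil) "x" "l'"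
     (IfNil (Call "split" [:: "l'"]) Nil "a" "b"
       (Cons (Cons "x" "b") "a"))).

Definition merge_fun : seq string * term :=
  ([:: "a"; "b"],
   IfNil "a" "b" "x" "a'"
     (IfNil "b" "a" "y" "b'"
       (IfNil "x" Nil "vx" "fx"
         (IfNil "y" Nil "vy" "fy"
           (IfLe "fx" "fy"
              (Cons "x" (Call "merge" [:: "a'"; "b"]))
              (Cons "y" (Call "merge" [:: "a"; "b'"]))))))).

Definition sort_fun : seq string * term :=
  ([:: "l"],
   IfNil "l" Nil "x" "l'"
     (IfNil "l'" "l" "y" "l''"
       (IfNil (Call "split" [:: "l"]) Nil "a" "b"
         (Let "c" (Call "sort" [:: "a"])
           (Let "d" (Call "sort" [:: "b"])
             (Call "merge" [:: "c"; "d"])))))).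

(* Forget the values again. *)
Definition elements_fun : seq string * term :=
  ([:: "l"],
   IfNil "l" Nil "x" "l'"
     (IfNil "x" Nil "v" "r" (Cons "v" (Call "elements" [:: "l'"])))).

(* k - 1 singletons, then the set of all remaining elements. *)
Definition parts_fun : seq string * term :=
  ([:: "l"; "k"],
   IfZero "k" Nil "j"
     (IfZero "j" (Cons (Call "elements" [:: "l"]) Nil) "i"
       (IfNil "l" Nil "x" "l'"
         (IfNil "x" Nil "v" "r"
           (Cons (Cons "v" Nil) (Call "parts" [:: "l'"; "j"])))))).

Definition main_fun : seq string * term :=
  ([:: "l"; "k"],
   Let "q" (Call "queries" [:: "l"])
     (Let "s" (Call "sort" [:: "q"])
       (Call "parts" [:: "s"; "k"]))).

Definition algorithm : program :=
  [:: ("main", main_fun); ("queries", queries_fun); ("sort", sort_fun);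
      ("split", split_fun); ("merge", merge_fun); ("parts", parts_fun);
      ("elements", elements_fun)].

End Algorithm.

(* Main.v *)
(* The optimum is at least f(V), since f is subadditive, and at least the sum of
   the k - 1 smallest singleton values: choosing one element in each part of a
   feasible partition gives k distinct elements, each of singleton value at most
   that of its part.  The output costs at most the sum of these two quantities.
   The running time is that of merge sort plus n oracle calls and linear work. *)

Require Import Defs.
From Stdlib Require Import String.
From mathcomp Require Import all_boot all_order all_algebra reals.
From mathcomp Require Import zify lra.

Set Implicit Arguments.
Unset Strict Implicit.
Unset Printing Implicit Defensive.

Import Order.TTheory GRing.Theory Num.Theory.
Local Open Scope ring_scope.

(** * Subadditivity and the two lower bounds on the optimum *)

Section Approximation.
Context {R : realType} {T : finType}.
Implicit Types (f : {set T} -> R) (A B : {set T}) (v : seq T) (k m : nat).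

(** The elements of [B] are added one at a time. With [C] the part already added, a new [x] outside
    [A :|: C] gains at most as much over [A :|: C] as over [C]; an [x] already inside leaves the
    union unchanged, and monotonicity suffices. *)
Lemma submodular_subadditive f A B :
  nonnegative f -> monotone f -> submodular f -> f (A :|: B) <= f A + f B.
Proof.
move=> f0 fM fS.
have -> : B = [set x in enum B] by apply/setP=> x; rewrite inE mem_enum.
elim: (enum B) => [|x s IH].
  by rewrite set_nil setU0 lerDl f0.
rewrite set_cons setUCA; set C := [set y in s] in IH *.
have [xAC|xAC] := boolP (x \in A :|: C).
  rewrite (setUidPr _) ?sub1set //; apply: (le_trans IH).
  by rewrite lerD2l fM // subsetUr.
by have := fS C (A :|: C) x (subsetUr _ _) xAC; lra.
Qed.

(** Keeping a first set [A] apart avoids a stray term [f set0], which need not vanish; [A] also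
    accumulates the union during the induction. *)
Lemma submodular_bigcup_le f A (I : Type) (r : seq I) (F : I -> {set T}) :
  nonnegative f -> monotone f -> submodular f ->
  f (A :|: \bigcup_(i <- r) F i) <= f A + \sum_(i <- r) f (F i).
Proof.
move=> f0 fM fS; elim: r A => [|i r IH] A; first by rewrite !big_nil setU0 addr0.
rewrite !big_cons setUA addrA; apply: (le_trans (IH _)).
by rewrite lerD2r submodular_subadditive.
Qed.

(** Exchange argument: a set [B] with more than [m] elements contains some [b] outside the first [m]
    entries of [v]. By sortedness [g b] is at least the value of the entry at index [m]; the
    induction continues with [B :\ b]. *)
Lemma sum_take_sorted_le (g : T -> R) v B m :
  (forall x, 0 <= g x) -> perm_eq v (enum T) ->
  sorted (fun x y => g x <= g y) v -> (m <= #|B|)%N ->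
  \sum_(x <- take m v) g x <= \sum_(x in B) g x.
Proof.
move=> g0 vT vS; elim: m B => [|m IH] B mB; first by rewrite take0 big_nil sumr_ge0.
have [vm|mv] := leqP (size v) m.
  by rewrite take_oversize ?leqW // -(take_oversize vm) IH // ltnW.
have /subsetPn[b bB bn] : ~~ (B \subset [set x in take m v]).
  apply: contraL mB => /subset_leq_card; rewrite -leqNgt => /leq_trans; apply.
  rewrite cardsE; apply: leq_trans (card_size _) _.
  by rewrite size_take_min geq_minl.
rewrite inE in bn.
have bv : b \in v by rewrite (perm_mem vT) mem_enum.
have mb : (m <= index b v)%N.
  by rewrite leqNgt; apply: contra bn => jm; rewrite in_take.
rewrite (take_nth b) // -cats1 big_cat big_seq1 /= addrC (big_setD1 b) //=.
rewrite lerD //; last first.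
  by apply: IH; move: mB; rewrite (cardsD1 b) bB.
(* The first occurrence of [b] is the default value of [nth]; only the right-hand side becomes an
   entry of [v]. *)
rewrite -{2}(nth_index b bv).
have := @sorted_leq_nth _ (fun x y => g x <= g y) _ _ b v vS m (index b v).
apply; rewrite ?inE ?index_mem //; by move=> y x z; apply: le_trans.
Qed.

Lemma feasible_value_ge_setT f k (S : k.-tuple {set T}) :
  (0 < k)%N -> nonnegative f -> monotone f -> submodular f ->
  feasible S -> f [set: T] <= value f S.
Proof.
case: k S => // k S _ f0 fM fS [<- _ _].
by rewrite /value !big_ord_recl submodular_bigcup_le.
Qed.

Lemma feasible_value_ge_singletons f k (S : k.-tuple {set T}) v m :
  (m <= k)%N -> nonnegative f -> monotone f ->
  perm_eq v (enum T) -> sorted (fun x y => f [set x] <= f [set y]) v ->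
  feasible S -> \sum_(x <- take m v) f [set x] <= value f S.
Proof.
move=> mk f0 fM vT vS [_ Sdisj Sne].
have /fin_all_exists[p pS] i : exists x, x \in tnth S i by exact/set0Pn.
have p_inj : injective p.
  move=> i j pij; apply/eqP/negPn/negP => /Sdisj/pred0P/(_ (p i)) /=.
  by rewrite pS pij pS.
apply: (@le_trans _ _ (\sum_(x in p @: 'I_k) f [set x])).
  by apply: sum_take_sorted_le => //; rewrite card_imset ?card_ord.
rewrite big_imset /=; last by move=> i j _ _ /p_inj.
by apply: ler_sum => i _; rewrite fM // sub1set.
Qed.

(** There are finitely many [k]-tuples of sets and feasibility has a boolean form [b], so one
    feasible tuple is enough for a minimizer to exist. *)
Lemma exists_optimal f k (S : k.-tuple {set T}) :
  feasible S -> exists Sopt : k.-tuple {set T}, optimal f Sopt.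
Proof.
pose b (S' : k.-tuple {set T}) :=
  [&& \bigcup_(i < k) tnth S' i == [set: T],
      [forall i, forall j, (i != j) ==> [disjoint tnth S' i & tnth S' j]]
    & [forall i, tnth S' i != set0]].
have bP S' : reflect (feasible S') (b S').
  apply: (iffP and3P) => [[/eqP ? d n]|[/eqP ? d n]]; split=> //.
  - by move=> i j; apply/implyP; move: d => /forallP/(_ i)/forallP/(_ j).
  - by apply/forallP.
  - by apply/forallP=> i; apply/forallP=> j; apply/implyP; apply: d.
  - by apply/forallP.
move=> /bP bS; case: (arg_minP (fun S' => value f S') bS) => S' /bP fS' minS'.
by exists S'; split=> // S'' /bP; apply: minS'.
Qed.

(** * Feasibility and approximation ratio of the output *)

Lemma algorithm_output_feasible f k (S : k.-tuple {set T}) :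
  (1 <= k <= #|T|)%N -> algorithm_output f S -> feasible S.
Proof.
move=> /andP[k0 kT] [v [vT _ ES]].
have vU : uniq v by rewrite (perm_uniq vT) enum_uniq.
have kv : (k.-1 < size v)%N by rewrite (perm_size vT) -cardT prednK.
split.
- rewrite -(big_tuple _ _ S xpredT id) ES -cats1 big_cat big_seq1 big_map /=.
  rewrite -[X in X :|: _](_ : [set x in take k.-1 v] = _) ?setUCr //.
  elim: (take _ _) => [|x s IH]; first by rewrite big_nil set_nil.
  by rewrite set_cons IH big_cons.
- have /(pairwiseP set0) P : pairwise (fun A B => [disjoint A & B]) S.
    rewrite ES pairwise_rcons pairwise_map all_map; apply/andP; split.
      by apply/allP=> x xv /=; rewrite disjoints1 !inE xv.
    have := take_uniq k.-1 vU; rewrite uniq_pairwise; apply: sub_pairwise => x y /=.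
    by rewrite disjoints1 inE.
  move=> i j; wlog ij : i j / (i < j)%N => [H|_].
    rewrite neq_ltn => /orP[] ij; first by apply: H => //; rewrite neq_ltn ij.
    by rewrite disjoint_sym; apply: H => //; rewrite neq_ltn ij.
  by rewrite !(tnth_nth set0); apply: P => //; rewrite inE size_tuple.
- apply/(@all_tnthP _ _ (fun A => A != set0)); rewrite ES all_rcons all_map.
  apply/andP; split.
    case: (v) kv vU => // x0 w; set u := x0 :: w => kv vU.
    (* The last part contains the first element not taken, at index [k.-1]; it exists because
       [k <= #|T|]. *)
    apply/set0Pn; exists (nth x0 u k.-1).
    by rewrite !inE in_take ?mem_nth // index_uniq // ltnn.
  by apply/allP=> x _ /=; apply/set0Pn; exists x; rewrite inE.
Qed.

Lemma algorithm_output_approx f k (S : k.-tuple {set T}) :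
  instance f k -> algorithm_output f S -> approx_solution 2 f S.
Proof.
move=> [k1T f0 fM fS] outS; have feasS := algorithm_output_feasible k1T outS.
split=> //; have [Sopt optS] := exists_optimal f feasS.
exists Sopt; split=> //; have [feasO _] := optS.
have [k0 _] := andP k1T; have [v [vT vS ES]] := outS.
rewrite {1}/value -(big_tuple _ _ S xpredT f) ES -cats1 big_cat big_seq1 big_map /=.
(* The singletons and the last part are each charged once to the optimum, the last part through [f
   [set: T]]. *)
have := feasible_value_ge_setT k0 f0 fM fS feasO.
have := feasible_value_ge_singletons (leq_pred k) f0 fM vT vS feasO.
have := fM (~: [set x in take k.-1 v]) _ (subsetT _).
by lra.
Qed.

End Approximation.

(** * Evaluation of the queries and of merge sort *)

Section RunningTime.
Context {R : realType} {T : finType}.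
Context (f : {set T} -> R) (EO : nat).
Local Open Scope nat_scope.
Local Notation ev := (eval algorithm f EO).
Local Notation leT := (fun x y : T => (f [set x] <= f [set y])%R).
Implicit Types (s : seq T) (k : nat).

(** The oracle's answer is cached beside the element, so sorting makes no further queries. *)
Definition vpair (x : T) : datum R T := VCons (VElt x) (VReal (f [set x])).
Definition vpairs s : datum R T := vlist [seq vpair x | x <- s].

(** Lets a derivation determine its own time first and leaves the arithmetic for last. *)
Lemma eval_time e a w t t' : ev e a w t -> t = t' -> ev e a w t'.
Proof. by move=> H <-. Qed.

Lemma eval_call1 e g x y body u w t :
  assoc g algorithm = Some ([:: y], body) -> assoc x e = Some u ->
  ev [:: (y, u)] body w t -> ev e (Call g [:: x]) w t.+1.
Proof. by move=> Eg Ex H; apply: (ECall (ws := [:: u]) Eg) => //=; rewrite Ex. Qed.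

Lemma eval_call2 e g x1 x2 y1 y2 body u1 u2 w t :
  assoc g algorithm = Some ([:: y1; y2], body) ->
  assoc x1 e = Some u1 -> assoc x2 e = Some u2 ->
  ev [:: (y1, u1); (y2, u2)] body w t -> ev e (Call g [:: x1; x2]) w t.+1.
Proof.
by move=> Eg E1 E2 H; apply: (ECall (ws := [:: u1; u2]) Eg) => //=; rewrite E1 E2.
Qed.

Lemma eval_queries s :
  ev [:: ("l"%string, velts s)] queries_fun.2 (vpairs s) (size s * (EO + 9) + 3).
Proof.
elim: s => [|x s IH].
  by apply: eval_time; [apply: EIfNil_nil; constructor | ].
apply: eval_time.
  apply: EIfNil_cons; first exact: EVar.
  apply: ECons.
    apply: ECons; first exact: EVar.
    (* [EQuery] returns the value of a set given by a list. *)
    rewrite [[set x]](_ : _ = [set y in [:: x]]); last first.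
      by apply/setP=> y; rewrite !inE.
    apply: (EQuery (s := [:: x])).
    by apply: ECons; constructor.
  by apply: eval_call1; [ | | exact: IH].
rewrite /=; lia.
Qed.

(** The two lists swap roles at each element, so the elements are dealt alternately and the sizes
    differ by at most one. *)
Lemma eval_split s : exists a b,
  [/\ perm_eq (a ++ b) s, size a = uphalf (size s), size b = (size s)./2
    & ev [:: ("l"%string, vpairs s)] split_fun.2 (VCons (vpairs a) (vpairs b))
        (size s * 9 + 5)].
Proof.
elim: s => [|x s [a [b [ab sa sb H]]]].
  exists [::], [::]; split=> //.
  by apply: eval_time; [apply: EIfNil_nil; [ | apply: ECons]; constructor | ].
exists (x :: b), a; split.
- by rewrite /= perm_cons perm_catC.
- by rewrite /= sb.
- by rewrite /= sa.
apply: eval_time.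
  apply: EIfNil_cons; first exact: EVar.
  apply: EIfNil_cons; first by apply: eval_call1; [ | | exact: H].
  by do 2?apply: ECons; apply: EVar.
rewrite /=; lia.
Qed.

(** The outer induction serves when the head of [a] is output, the inner one when that of [b] is.
    Time is only bounded, since the values decide which list runs out first; each output costs 14
    units. *)
Lemma eval_merge (a b : seq T) : exists2 t, t <= (size a + size b) * 20 + 5 &
  ev [:: ("a"%string, vpairs a); ("b"%string, vpairs b)] merge_fun.2
    (vpairs (merge leT a b)) t.
Proof.
elim: a b => [|x a IHa] b.
  exists 3; first by lia.
  by apply: eval_time; [apply: EIfNil_nil; apply: EVar | ].
elim: b => [|y b [tb tb_le IHb]].
  exists 5; first by lia.
  apply: eval_time.
    apply: EIfNil_cons; first exact: EVar.
    by apply: EIfNil_nil; apply: EVar.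
  by [].
have [ta ta_le {}IHa] := IHa (y :: b).
have [xy|yx] := boolP (leT x y).
  exists (ta + 14); first by move: ta_le => /=; lia.
  rewrite /= xy; apply: eval_time.
    do 4 (apply: EIfNil_cons; first exact: EVar).
    apply: EIfLe_true; [exact: EVar | exact: EVar | exact: xy | ].
    apply: ECons; first exact: EVar.
    by apply: eval_call2; [ | | | exact: IHa].
  rewrite /=; lia.
exists (tb + 14); first by move: tb_le => /=; lia.
rewrite /= (negPf yx); apply: eval_time.
  do 4 (apply: EIfNil_cons; first exact: EVar).
  apply: EIfLe_false; [exact: EVar | exact: EVar | by rewrite ltNge | ].
  apply: ECons; first exact: EVar.
  by apply: eval_call2; [ | | | exact: IHb].
rewrite /=; lia.
Qed.

Lemma eval_sort1 x :
  ev [:: ("l"%string, vpairs [:: x])] sort_fun.2 (vpairs [:: x]) 5.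
Proof.
apply: eval_time.
  apply: EIfNil_cons; first exact: EVar.
  by apply: EIfNil_nil; apply: EVar.
by [].
Qed.

(* Bounding the length by a power of 2 makes the induction on j insensitive to
   the rounding in both halves; 60 absorbs the linear cost of split and merge. *)
Lemma eval_sort j s : 0 < size s <= 2 ^ j -> exists s' t,
  [/\ perm_eq s' s, sorted leT s', t <= 60 * size s * j.+1
    & ev [:: ("l"%string, vpairs s)] sort_fun.2 (vpairs s') t].
Proof.
elim: j s => [|j IH] [|x [|y s]] //= => [_|_|].
- exists [:: x], 5; split=> //.
  exact: eval_sort1.
- exists [:: x], 5; split=> //; first by lia.
  exact: eval_sort1.
rewrite -[(size s).+2]/(size [:: x, y & s]); set l := [:: x, y & s] => sl.
(* Both halves are then nonempty, as the induction hypothesis requires. *)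
have sl2 : 1 < size l by [].
have [a [b [ab sa sb Hsplit]]] := eval_split l.
have sab : size a + size b = size l by rewrite -size_cat (perm_size ab).
have [|a' [ta [aa' Sa ta_le Ha]]] := IH a.
  by move: sl; rewrite sa expnS; lia.
have [|b' [tb [bb' Sb tb_le Hb]]] := IH b.
  by move: sl; rewrite sb expnS; lia.
have [tm tm_le Hm] := eval_merge a' b'.
move: tm_le; rewrite (perm_size aa') (perm_size bb') sab => tm_le.
exists (merge leT a' b'), (ta + tb + tm + size l * 9 + 16); split.
- by rewrite perm_merge; apply: perm_trans ab; apply: perm_cat.
- by apply: merge_sorted => // u w; apply: le_total.
(* The budget splits into those of the two recursive calls plus [60 * size l], which covers the
   remaining cost of at most [29 * size l + 21]. *)
- have -> : 60 * size l * j.+2 = 60 * size a * j.+1 + 60 * size b * j.+1 + 60 * size l.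
    by rewrite -sab; lia.
  move: ta_le tb_le tm_le sl2; clear.
  move: (60 * size a * _) (60 * size b * _) (size l) => *; lia.
apply: eval_time.
  apply: EIfNil_cons; first exact: EVar.
  apply: EIfNil_cons; first exact: EVar.
  apply: EIfNil_cons; first by apply: eval_call1; [ | | exact: Hsplit].
  apply: ELet; first by apply: eval_call1; [ | | exact: Ha].
  apply: ELet; first by apply: eval_call1; [ | | exact: Hb].
  by apply: eval_call2; [ | | | exact: Hm].
rewrite /=; lia.
Qed.

(** * Output of the partition and total running time *)

Lemma eval_elements s :
  ev [:: ("l"%string, vpairs s)] elements_fun.2 (velts s) (size s * 7 + 3).
Proof.
elim: s => [|x s IH].
  by apply: eval_time; [apply: EIfNil_nil; constructor | ].
apply: eval_time.
  do 2 (apply: EIfNil_cons; first exact: EVar).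
  apply: ECons; first exact: EVar.
  by apply: eval_call1; [ | | exact: IH].
rewrite /=; lia.
Qed.

(** An element costs 13 units when peeled off as a singleton and 7 when copied into the last part,
    so 13 per element bounds both. The hypothesis on [k] keeps the list from running out before the
    last part. *)
Lemma eval_parts k s : 0 < k <= size s -> exists2 t, t <= size s * 13 + 10 &
  ev [:: ("l"%string, vpairs s); ("k"%string, VNat k)] parts_fun.2
    (vlist [seq velts r | r <- rcons [seq [:: x] | x <- take k.-1 s] (drop k.-1 s)])
    t.
Proof.
elim: s k => [|x s IH] [|[|k]] // ks.
  exists (size (x :: s) * 7 + 10); first by rewrite /=; lia.
  apply: eval_time.
    apply: EIfZero_S; first exact: EVar.
    apply: EIfZero_0; first exact: EVar.
    apply: ECons; last exact: ENil.
    by apply: eval_call1; [ | | exact: eval_elements].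
  rewrite /=; lia.
have [|t t_le H] := IH k.+1; first by move: ks => /=; lia.
exists (t + 13); first by move: t_le => /=; lia.
apply: eval_time.
  do 2 (apply: EIfZero_S; first exact: EVar).
  do 2 (apply: EIfNil_cons; first exact: EVar).
  apply: ECons; first by apply: ECons; constructor.
  by apply: eval_call2; [ | | | exact: H].
rewrite /=; lia.
Qed.

Lemma algorithm_running_time (l : seq T) k :
  0 < k <= #|T| -> 0 < EO -> perm_eq l (enum T) ->
  exists (S : k.-tuple {set T}) t,
    [/\ runs algorithm f EO l S t, algorithm_output f S
      & t <= 1000 * (#|T| * EO + #|T| * trunc_log 2 #|T|)].
Proof.
move=> kT EO0 lT.
have sl : size l = #|T| by rewrite (perm_size lT) -cardT.
have kl : 0 < k <= size l by rewrite sl.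
(* [trunc_log] rounds down, so its successor is the exponent that bounds the length. *)
have [|v [ts [vl vS ts_le Hs]]] := @eval_sort (trunc_log 2 #|T|).+1 l.
  by rewrite sl; move: kT (trunc_log_ltn #|T| (isT : 1 < 2)); lia.
have vT := perm_trans vl lT; have sv := perm_size vl.
have [|tp tp_le Hp] := @eval_parts k v; first by rewrite sv.
pose S := rcons [seq [set x] | x <- take k.-1 v] (~: [set x in take k.-1 v]).
have sS : size S == k.
  have [k0 kn] := andP kT.
  by rewrite size_rcons size_map size_takel ?prednK // sv sl (leq_trans (leq_pred k)).
exists (Tuple sS), (size l * (EO + 9) + ts + tp + 9).
have vU : uniq v by rewrite (perm_uniq vT) enum_uniq.
split; last 1 first.
(* The linear and constant terms are absorbed by [#|T| * EO], as [EO] and [#|T|] are positive; the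
   logarithmic term could not do this, being 0 for a single element. *)
- move: tp_le ts_le; rewrite sv sl; nia.
- exists (rcons [seq [:: x] | x <- take k.-1 v] (drop k.-1 v)); split.
  + by rewrite all_rcons drop_uniq //= all_map; apply/allP.
  + rewrite map_rcons -map_comp /= /S; congr rcons.
      by apply: eq_map => x; apply/setP=> y; rewrite !inE.
    (* Since [v] lists every element exactly once, the dropped entries represent the complement of
       the taken ones. *)
    apply/setP=> x; rewrite !inE.
    have : x \in v by rewrite (perm_mem vT) mem_enum.
    move: vU; rewrite -{1 2}(cat_take_drop k.-1 v) cat_uniq mem_cat.
    move=> /and3P[_ /hasPn d _].
    have [xd _|_] := boolP (x \in drop _ _); first by rewrite (negPf (d _ xd)).
    by rewrite orbF => ->.
  + apply: eval_time.
      apply: eval_call2; [by [] | by [] | by [] | ].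
      apply: ELet; first by apply: eval_call1; [ | | exact: (eval_queries l)].
      apply: ELet; first by apply: eval_call1; [ | | exact: Hs].
      by apply: eval_call2; [ | | | exact: Hp].
    lia.
- by exists v.
Qed.

End RunningTime.

Theorem corollary2 (R : realType) :
  (forall (T : finType) (k : nat) (f : {set T} -> R) (S : k.-tuple {set T}),
     instance f k -> algorithm_output f S -> approx_solution 2 f S)
  /\
  (exists c : nat,
     forall (T : finType) (k : nat) (f : {set T} -> R) (EO : nat) (l : seq T),
       instance f k -> (0 < EO)%N -> perm_eq l (enum T) ->
       exists (S : k.-tuple {set T}) (t : nat),
         [/\ runs algorithm f EO l S t,
             algorithm_output f S
           & (t <= c * (#|T| * EO + #|T| * trunc_log 2 #|T|))%N]).
Proof.
split=> [T k f S|]; first exact: algorithm_output_approx.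
exists 1000%N => T k f EO l [kT _ _ _].
exact: algorithm_running_time.
Qed.
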